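(* For every integer $n>4$, the star graph $K_{1,n}$ is not a $G_\phi$-graph.
   Context: $\phi$ denotes Euler's totient function, $\phi^0(n)=n$ and $\phi^i(n)=\phi(\phi^{i-1}(n))$. For a set $A$ of positive integers, $A_\phi=\{\phi^k(n): n\in A,\ k\ge 0\}$, and $G_\phi(A)$ is the simple graph with vertex set $A_\phi$ in which distinct vertices $r,s$ are adjacent iff $\phi(r)=s$ or $\phi(s)=r$. A graph $H$ is a $G_\phi$-graph if there exists a set $A$ of positive integers such that $H$ is (isomorphic to) $G_\phi(A)$. $K_{1,n}$ is the star with one center and $n$ leaves. *)

(* Defs.v *)
From mathcomp Require Import all_boot.
From mathcomp Require Import boolp classical_sets.

Set Implicit Arguments.
Unset Strict Implicit.
Unset Printing Implicit Defensive.

Local Open Scope classical_set_scope.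

(* The vertex type may be infinite: a set A of positive integers need not be
   finite. *)
Record simple_graph := SimpleGraph {
  vertex : Type;
  adj : vertex -> vertex -> Prop;
  adj_sym : forall x y, adj x y -> adj y x;
  adj_irrefl : forall x, ~ adj x x
}.

Definition graph_iso (G H : simple_graph) : Prop :=
  exists f : vertex G -> vertex H,
    bijective f /\ forall x y, adj x y <-> adj (f x) (f y).

Definition totient_closure (A : set nat) : set nat :=
  [set m | exists n k, A n /\ m = iter k totient n].

(* A vertex is an element of the subtype [set_type] of integers lying in the
   set; two vertices are equal iff the underlying integers are. *)
Definition totient_adj (A : set nat) (r s : totient_closure A) : Prop :=
  r <> s /\ (totient (val r) = val s \/ totient (val s) = val r).

Lemma totient_adj_sym (A : set nat) (r s : totient_closure A) :
  totient_adj r s -> totient_adj s r.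
Proof. by case=> neq_rs [rs | sr]; split; auto. Qed.

Lemma totient_adj_irrefl (A : set nat) (r : totient_closure A) :
  ~ totient_adj r r.
Proof. by case. Qed.

Definition totient_graph (A : set nat) : simple_graph :=
  SimpleGraph (@totient_adj_sym A) (@totient_adj_irrefl A).

Definition is_totient_graph (H : simple_graph) : Prop :=
  exists A : set nat, (forall n, A n -> 0 < n) /\ graph_iso H (totient_graph A).

(* The star K_{1,n}: [None] is the center, the [Some i] are the n leaves. *)
Definition star_adj (n : nat) (u v : option 'I_n) : Prop :=
  (u = None /\ v <> None) \/ (u <> None /\ v = None).

Lemma star_adj_sym (n : nat) (u v : option 'I_n) :
  star_adj u v -> star_adj v u.
Proof. by case=> [[? ?]|[? ?]]; [right | left]. Qed.

Lemma star_adj_irrefl (n : nat) (u : option 'I_n) : ~ star_adj u u.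
Proof. by case=> [[? ?]|[? ?]]. Qed.

Definition star (n : nat) : simple_graph :=
  SimpleGraph (@star_adj_sym n) (@star_adj_irrefl n).

(* Main.v *)
(* In [totient_graph A] every vertex other than 1 is adjacent to its totient,
   and 1 is always a vertex.  If 1 is the center of a star, every leaf [v] has
   [totient v = 1], so [v = 2] is the only leaf.  Otherwise the center [c] is
   adjacent to the leaf 1, so [totient c = 1] and [c = 2]; the other leaves then
   satisfy [totient v = 2], so all leaves lie in {1, 3, 4, 6}. *)
Require Import Defs.
From mathcomp Require Import all_boot.
From mathcomp Require Import boolp classical_sets.
From mathcomp Require Import zify.

Lemma totient_filter (n : nat) :
  totient n = size [seq d <- iota 0 n | coprime n d].
Proof.
by rewrite totient_count_coprime size_filter -sum1_count [RHS]big_mkcond /index_iota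
  subn0; apply: eq_bigr => d _; case: coprime.
Qed.

Lemma size_le_totient (n : nat) (s : seq nat) :
  uniq s -> all (fun d => (d < n) && coprime n d) s -> size s <= totient n.
Proof.
move=> s_uniq /allP sP; rewrite totient_filter; apply: uniq_leq_size => // d.
by move=> /sP /andP[dn cop]; rewrite mem_filter cop mem_iota.
Qed.

(** For [1 < n] the residue 0 is not coprime to [n], so at most [n - 1] residues are counted. *)
Lemma totient_lt (n : nat) : 1 < n -> totient n < n.
Proof.
case: n => [|[|n]] // _; rewrite totient_filter size_filter ltnS.
rewrite -[iota 0 _]/([:: 0] ++ iota 1 n.+1) count_cat -[leqRHS](size_iota 1).
exact: count_size.
Qed.

(** Together with 1 and [n - 1], this [d] gives three units modulo [n]. *)
Lemma exists_third_coprime (n : nat) :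
  6 < n -> exists d, [/\ 1 < d, d < n.-1 & coprime n d].
Proof.
move=> n6; have [n_odd|n_even] := boolP (odd n).
  by exists 2; rewrite coprimen2; split => //; lia.
pose m := n./2; have -> : n = 2 * m by rewrite mul2n /m; lia.
have m3 : 3 < m by rewrite /m; lia.
(* The witness is odd, hence prime to 2, and differs from [m] by 2 or 1; being odd, it is then prime
   to [m]. *)
have [m_odd|m_even] := boolP (odd m); [exists (m - 2) | exists m.-1];
  split; try lia.
  have a_odd : odd (m - 2) by lia.
  rewrite coprimeMl coprime2n a_odd /= coprime_sym /coprime.
  by rewrite -{2}(subnK (ltnW (ltnW m3))) gcdnDl -/(coprime _ _) coprimen2.
rewrite coprimeMl coprime2n coprimenP ?andbT; lia.
Qed.

Lemma totient_gt2 (n : nat) : 6 < n -> 2 < totient n.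
Proof.
move=> n6; have [d [d1 dn cop]] := exists_third_coprime n n6.
apply: (@size_le_totient n [:: 1; d; n.-1]).
  by rewrite /= !inE; lia.
by rewrite /= cop coprimen1 coprimenP; lia.
Qed.

Lemma totient_eq1 (n : nat) : totient n = 1 -> n \in [:: 1; 2].
Proof.
move=> n1; have := totient_gt0 n; have := totient_gt1 n.
by rewrite n1 !inE; lia.
Qed.

Lemma totient_eq2 (n : nat) : totient n = 2 -> n \in [:: 3; 4; 6].
Proof.
move=> n2; have [/totient_gt2|] := ltnP 6 n; first by rewrite n2.
(* Only the values up to 6 remain, each decided by evaluation. *)
by move: n2; do 7![case: n => [//|n]].
Qed.

Lemma iter_totient_eq1 (n : nat) : 0 < n -> exists k, iter k totient n = 1.
Proof.
elim/ltn_ind: n => n IH n0; have [n1|n1] := ltnP 1 n; last by exists 0 => /=; lia.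
have [|k kE] := IH _ (totient_lt n n1); first by rewrite totient_gt0.
by exists k.+1; rewrite iterSr.
Qed.

Lemma totient_closure1 (A : set nat) (m : nat) :
  (forall n, A n -> 0 < n) -> totient_closure A m -> totient_closure A 1.
Proof.
move=> A0 [n [_ [An _]]]; have [k kE] := iter_totient_eq1 n (A0 n An).
by exists n, k.
Qed.

(** Pigeonhole, used to bound the number of leaves by listing their possible values. *)
Lemma inj_ord_leq_size (T : eqType) (n : nat) (f : 'I_n -> T) (s : seq T) :
  injective f -> (forall i, f i \in s) -> n <= size s.
Proof.
move=> f_inj fs; rewrite -(size_enum_ord n) -(size_map f).
apply: uniq_leq_size; first by rewrite map_inj_uniq ?enum_uniq.
by move=> _ /mapP[i _ ->].
Qed.

Theorem theorem2p9 (n : nat) (hn : 4 < n) : ~ is_totient_graph (star n).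
Proof.
case=> A [A0 [f [[g fK gK] f_adj]]].
pose v x : nat := val (f x).
have v_inj : injective v by move=> x y /val_inj /(can_inj fK).
have leaf_inj : injective (v \o Some) by move=> i j /v_inj [].
have leaf_adj i : totient (v None) = v (Some i) \/ totient (v (Some i)) = v None.
  by have /f_adj[] : @adj (star n) None (Some i) by left.
have A1 : totient_closure A 1.
  by apply: (totient_closure1 A (v None) A0); apply: set_mem; exact: valP.
(* Surjectivity of [f] places 1 at some vertex of the star. *)
have [x x1] : exists x, v x = 1.
  by exists (g (SigSub (mem_set A1))); rewrite /v gK.
case: x x1 => [i|] x1.
  have c2 : v None = 2.
    have c_neq1 : v None <> 1 by rewrite -x1 => /v_inj.
    move: (leaf_adj i); rewrite x1 => -[/totient_eq1|c1]; last by case: c_neq1.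
    by rewrite !inE => /orP[/eqP|/eqP].
  suff : n <= size [:: 1; 3; 4; 6] by rewrite leqNgt hn.
  apply: (@inj_ord_leq_size _ _ (v \o Some)) => // j /=.
  (* As [totient 2] evaluates to 1, the first alternative is the leaf 1. *)
  move: (leaf_adj j); rewrite c2 => -[<- //|/totient_eq2].
  by rewrite [_ \in 1 :: _]inE => ->; rewrite orbT.
suff : n <= size [:: 2] by rewrite leqNgt (leq_trans _ hn).
apply: (@inj_ord_leq_size _ _ (v \o Some)) => // j /=.
have l_neq1 : v (Some j) <> 1 by rewrite -x1 => /v_inj.
(* As [totient 1] evaluates to 1, the first alternative would equate the leaf with the center. *)
move: (leaf_adj j); rewrite x1 => -[l1|/totient_eq1]; first by case: l_neq1.
by rewrite !inE => /orP[/eqP|].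
Qed.
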